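(* Let $E$ be a reflexive real Banach space whose norm is uniformly Gâteaux differentiable, and suppose that $E$ has the fixed point property for nonexpansive mappings. Let $C$ be a nonempty closed convex subset of $E$, $\{\alpha_n\}_{n\in\mathbb N}$ a sequence in $(0,1]$ with $\alpha_n\to0$ and $\sum_{n=1}^\infty\alpha_n=\infty$, and $u$ a point in $C$. Let $T$ be a strongly nonexpansive self-mapping of $C$ and $\{x_n\}$ the sequence defined by $x_1\in C$ (arbitrary) and $$x_{n+1}=\alpha_nu+(1-\alpha_n)Tx_n\qquad(n\in\mathbb N).$$ Suppose that $\mathrm F(T)$ is nonempty. Then $\{x_n\}$ converges strongly (i.e. in norm) to $Qu$, where $Q$ is the sunny nonexpansive retraction of $C$ onto $\mathrm F(T)$.
   Context: $\mathbb N$ is the set of positive integers. For a mapping $T\colon C\to E$ with $C\subset E$, $\mathrm F(T)=\{x\in C: Tx=x\}$. $T$ is nonexpansive if $\|Tx-Ty\|\le\|x-y\|$ for all $x,y\in C$; $T$ is strongly nonexpansive if $T$ is nonexpansive and $x_n-y_n-(Tx_n-Ty_n)\to0$ whenever $\{x_n\},\{y_n\}$ are sequences in $C$ such that $\{x_n-y_n\}$ is bounded and $\|x_n-y_n\|-\|Tx_n-Ty_n\|\to0$. With $U_E=\{x\in E:\|x\|=1\}$, the norm of $E$ is uniformly Gâteaux differentiable if for each $y\in U_E$ the limit $\lim_{t\to0}(\|x+ty\|-\|x\|)/t$ exists for all $x\in U_E$ and is attained uniformly for $x\in U_E$. $E$ has the fixed point property for nonexpansive mappings if every nonexpansive self-mapping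 of a nonempty bounded closed convex subset $D$ of $E$ has a fixed point in $D$. For nonempty $K\subset C$, a mapping $Q$ of $C$ onto $K$ is a retraction if $Qx=x$ for all $x\in K$; it is sunny if $Q(Qx+\lambda(x-Qx))=Qx$ whenever $x\in C$, $\lambda\ge0$ and $Qx+\lambda(x-Qx)\in C$. A sunny nonexpansive retraction is a retraction that is sunny and nonexpansive. It is known that, when $E$ is a reflexive real Banach space whose norm is uniformly Gâteaux differentiable, $E$ has the fixed point property for nonexpansive mappings, and $C$ is a nonempty closed convex subset of $E$, for a nonexpansive self-mapping $T$ of $C$ with $\mathrm F(T)\ne\emptyset$ there is a unique sunny nonexpansive retraction of $C$ onto $\mathrm F(T)$. *)

(* Defs.v *)
From HB Require Import structures.
From mathcomp Require Import all_boot all_order all_algebra.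
From mathcomp Require Import all_classical all_reals all_analysis.

Set Implicit Arguments.
Unset Strict Implicit.
Unset Printing Implicit Defensive.

Import Order.TTheory GRing.Theory Num.Theory.
Import numFieldNormedType.Exports.

Local Open Scope classical_set_scope.
Local Open Scope ring_scope.

Section dual.
Variables (R : realType) (E : normedModType R).

Definition is_functional : {pred E -> R^o} :=
  mem [set f : E -> R^o | linear f /\ continuous f].

Lemma is_functional_submod_closed : submod_closed is_functional.
Proof.
split; first by rewrite inE; split=> [a x y|x]; [rewrite /= scaler0 addr0|exact: cvg_cst].
move=> a f g; rewrite !inE => -[lf cf] [lg cg]; split=> [b x y|x].
  change (a *: f (b *: x + y) + g (b *: x + y) =
          b *: (a *: f x + g x) + (a *: f y + g y)).
  rewrite lf lg !scalerDr !scalerA (mulrC a b) -!addrA; congr (_ + _).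
  by rewrite addrCA.
by apply: cvgD; [apply: cvgZl_tmp; exact: cf|exact: cg].
Qed.

HB.instance Definition _ := GRing.isSubmodClosed.Build _ _ is_functional
  is_functional_submod_closed.

(* The space E^* of continuous linear functionals on E. *)
Record dual := Dual { dual_fun :> E -> R^o ; _ : dual_fun \in is_functional }.

HB.instance Definition _ := [isSub for dual_fun].
HB.instance Definition _ := [Choice of dual by <:].
HB.instance Definition _ := [SubChoice_isSubLmodule of dual by <:].

Definition dual_norm (f : dual) : R :=
  sup [set `|f x| | x in [set x : E | `|x| <= 1]].

Lemma dual_linear (f : dual) : linear f.
Proof. by case: f => f /= /[!inE] -[]. Qed.

HB.instance Definition _ (f : dual) :=
  GRing.isLinear.Build R E R^o _ (dual_fun f) (@dual_linear f).

Lemma dual_continuous (f : dual) : continuous f.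
Proof. by case: f => f /= /[!inE] -[]. Qed.

Lemma dual_has_sup (f : dual) :
  has_sup [set `|f x| | x in [set x : E | `|x| <= 1]].
Proof.
split; first by exists `|f 0|, 0 => //=; rewrite normr0.
have [_ /(_ (@dual_continuous f)) bg] := linear_bounded_continuous (f : {linear E -> R^o}).
have [_ /(_ bg) /(_ 1)[M hM]] := bounded_funP (f : {linear E -> R^o}).
by exists M => _ [x /= x1 <-]; exact: hM.
Qed.

Lemma dual_norm_ub (f : dual) x : `|x| <= 1 -> `|f x| <= dual_norm f.
Proof. by move=> x1; apply: sup_upper_bound; [exact: dual_has_sup|exists x]. Qed.

Lemma dual_norm_le (f : dual) M :
  (forall x, `|x| <= 1 -> `|f x| <= M) -> dual_norm f <= M.
Proof.
move=> h; apply: ge_sup; first by have [] := dual_has_sup f.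
by move=> _ [x /= x1 <-]; exact: h.
Qed.

Lemma ler_dual_normD f g : dual_norm (f + g) <= dual_norm f + dual_norm g.
Proof.
apply: dual_norm_le => x x1; apply: le_trans (ler_normD (f x) (g x)) _.
by rewrite lerD// dual_norm_ub.
Qed.

Lemma dual_normZ_le a f : dual_norm (a *: f) <= `|a| * dual_norm f.
Proof.
apply: dual_norm_le => x x1.
have -> : `|(a *: f) x| = `|a| * `|f x| by rewrite -normrM.
by rewrite ler_wpM2l// dual_norm_ub.
Qed.

Lemma dual_normZ a f : dual_norm (a *: f) = `|a| * dual_norm f.
Proof.
apply/eqP; rewrite eq_le dual_normZ_le /=.
have [->|a0] := eqVneq a 0.
  rewrite normr0 mul0r (le_trans (normr_ge0 ((0 *: f) 0)))// dual_norm_ub//.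
  by rewrite normr0.
rewrite -ler_pdivlMl ?normr_gt0//.
have := dual_normZ_le a^-1 (a *: f).
by rewrite scalerA mulVf// scale1r normfV.
Qed.

Lemma dual_norm_eq0 f : dual_norm f = 0 -> f = 0.
Proof.
move=> f0; apply/val_inj/funext => x; change (f x = 0).
have [->|x0] := eqVneq x 0; first exact: linear0.
have nx0 : `|x| != 0 by rewrite normr_eq0.
have : `|f (`|x|^-1 *: x)| <= 0.
  by rewrite -f0 dual_norm_ub// normrZ normfV normr_id mulVf.
rewrite normr_le0 linearZ /= mulf_eq0 invr_eq0 (negbTE nx0) /=.
by move/eqP.
Qed.

HB.instance Definition _ := Lmodule_isNormed.Build R dual
  ler_dual_normD dual_normZ dual_norm_eq0.

End dual.

Section definitions.
Variables (R : realType) (E : normedModType R).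
Implicit Types (C K D : set E) (T Q : E -> E).

(* The canonical embedding of E into its bidual is onto. *)
Definition reflexive_space :=
  forall Phi : dual (dual E), exists x : E, forall f : dual E, Phi f = f x.

Definition unit_sphere : set E := [set x | `|x| = 1].

Definition uniformly_Gateaux_differentiable_norm :=
  forall y, unit_sphere y -> exists L : E -> R,
    {uniform unit_sphere,
      (fun (t : R) (x : E) => (`|x + t *: y| - `|x|) / t) @ 0^' --> L}.

(* A mapping of C into E is represented by a total function T : E -> E of
   which only the values on C matter. *)

Definition fixed_points C T : set E := [set x | C x /\ T x = x].

Definition nonexpansive C T :=
  forall x y, C x -> C y -> `|T x - T y| <= `|x - y|.

Definition strongly_nonexpansive C T :=
  nonexpansive C T /\
  forall x y : nat -> E, (forall n, C (x n)) -> (forall n, C (y n)) ->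
    bounded_fun (fun n => x n - y n) ->
    `|x n - y n| - `|T (x n) - T (y n)| @[n --> \oo] --> (0 : R) ->
    x n - y n - (T (x n) - T (y n)) @[n --> \oo] --> (0 : E).

Definition nonexpansive_fixed_point_property :=
  forall D, D !=set0 -> bounded_set D -> closed D -> convex_set D ->
  forall T, set_fun D D T -> nonexpansive D T -> fixed_points D T !=set0.

Definition retraction C K Q :=
  [/\ set_fun C K Q, set_surj C K Q & forall x, K x -> Q x = x].

Definition sunny C Q :=
  forall x (l : R), C x -> 0 <= l -> C (Q x + l *: (x - Q x)) ->
    Q (Q x + l *: (x - Q x)) = Q x.

Definition sunny_nonexpansive_retraction C K Q :=
  [/\ retraction C K Q, sunny C Q & nonexpansive C Q].

End definitions.

Arguments reflexive_space {R} E.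
Arguments uniformly_Gateaux_differentiable_norm {R} E.
Arguments nonexpansive_fixed_point_property {R} E.

(* Main.v *)
(* Halpern iteration x_(n+1) = alpha_n u + (1 - alpha_n) T x_n. Let j be the
   normalized duality map; uniform Gateaux differentiability makes
   x |-> j x y uniformly continuous on bounded sets for each y.

   For t in (0, 1] let z_t = t u + (1 - t) T z_t. By reflexivity the points of C
   minimizing limsup |z_(1/n) - y| form a nonempty bounded closed convex
   T-invariant set, so T has a fixed point p there; minimality against
   p + s (u - p) shows that the path clusters strongly at p. If |y - T y| <= e then
   t <u - z_t, j (y - z_t)> <= (1 - t) e |y - z_t|, whence <u - p, j (y - p)> is
   at most small for approximate fixed points y, and nonpositive for fixed points.
   The latter variational inequality characterizes p = Q u.

   Strong nonexpansiveness says that x_n is an approximate fixed point unless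
   |T x_n - p| is smaller than |x_n - p| by a definite amount. So at each step
   either |x_n - p| drops by a definite amount, or
   |x_(n+1) - p|^2 <= (1 - alpha_n) |x_n - p|^2 + 2 alpha_n <u - p, j (x_(n+1) - p)>
   with a small last term; divergence of sum alpha_n then forces |x_n - p| -> 0. *)
Require Import Defs.
From mathcomp Require Import all_boot all_order all_algebra.
From mathcomp Require Import all_classical all_reals all_analysis.
From mathcomp Require Import ring lra.

Import Order.TTheory GRing.Theory Num.Theory.
Import numFieldNormedType.Exports.

Local Open Scope classical_set_scope.
Local Open Scope ring_scope.

Set Implicit Arguments.
Unset Strict Implicit.
Unset Printing Implicit Defensive.

(** * Hahn-Banach and weak compactness *)

Section sublinear.
Variables (R : realType) (E : lmodType R).

Definition sublinear (p : E -> R) :=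
  (forall x y, p (x + y) <= p x + p y) /\
  (forall a x, 0 <= a -> p (a *: x) <= a * p x).

Lemma sublinear0 p : sublinear p -> p 0 = 0.
Proof.
move=> [pD pZ]; apply/eqP; rewrite eq_le; apply/andP; split.
  by have := pZ 0 0 (lexx _); rewrite scale0r mul0r.
by have := pD 0 0; rewrite addr0; lra.
Qed.

Lemma sublinear_geN p x : sublinear p -> - p (- x) <= p x.
Proof.
by move=> sp; have := sp.1 x (- x); rewrite subrr sublinear0//; lra.
Qed.

Lemma sublinearZ p a x : sublinear p -> 0 <= a -> p (a *: x) = a * p x.
Proof.
move=> sp; rewrite le_eqVlt => /predU1P[<-|a0].
  by rewrite scale0r mul0r sublinear0.
apply/eqP; rewrite eq_le sp.2 ?(ltW a0)//=.
have := sp.2 a^-1 (a *: x); rewrite scalerA mulVf ?gt_eqF// scale1r.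
by rewrite invr_ge0 (ltW a0) => /(_ isT); rewrite mulrC ler_pdivlMr// mulrC.
Qed.

(** Common source of the infima of chains, the minimality test and the separation gauge below. The
    [F i] need not be sublinear one by one: the index may change, so it is enough that the family is
    closed under the two operations. *)
Lemma inf_sublinear (I : Type) (A : set I) (F : I -> E -> R) :
    (forall x, has_lbound [set F i x | i in A]) ->
    (exists2 i, A i & F i 0 <= 0) ->
    (forall i j x y, A i -> A j ->
      exists2 k, A k & F k (x + y) <= F i x + F j y) ->
    (forall i a x, A i -> 0 < a -> exists2 k, A k & F k (a *: x) <= a * F i x) ->
  sublinear (fun x => inf [set F i x | i in A]).
Proof.
move=> Fl [i0 Ai0 Fi0] FD FZ.
have infF i x : A i -> inf [set F i x | i in A] <= F i x.
  by move=> Ai; apply: ge_inf; [exact: Fl|exists i].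
have Finf c x : (forall i, A i -> c <= F i x) -> c <= inf [set F i x | i in A].
  move=> h; apply: lb_le_inf; first by exists (F i0 x), i0.
  by move=> _ [i Ai <-]; exact: h.
split=> [x y|a x].
  rewrite -lerBlDr; apply: (Finf) => i Ai; rewrite lerBlDr -lerBlDl.
  apply: (Finf) => j Aj; rewrite lerBlDl.
  by have [k Ak] := FD i j x y Ai Aj; apply: le_trans; exact: infF.
rewrite le_eqVlt => /predU1P[<-|a0].
  by rewrite scale0r mul0r; exact: le_trans (infF _ _ Ai0) Fi0.
rewrite -ler_pdivrMl//; apply: (Finf) => i Ai; rewrite ler_pdivrMl//.
by have [k Ak] := FZ i a x Ai a0; apply: le_trans; exact: infF.
Qed.

(** Zorn's lemma for the reversed pointwise order. The infimum of a chain is finite because every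
    [s] below [q] satisfies [s x >= - s (- x) >= - q (- x)]. *)
Lemma minimal_sublinear (q : E -> R) : sublinear q ->
  exists p, [/\ sublinear p, forall x, p x <= q x &
    forall p', sublinear p' -> (forall x, p' x <= p x) -> p' = p].
Proof.
move=> sq; pose T := {p | sublinear p /\ forall x, p x <= q x}.
pose below (p p' : T) := `[< forall x, sval p' x <= sval p x >].
have [| | | |p pmin] := @Zorn T below.
- by move=> p; apply/asboolP.
- move=> p1 p2 p3 /asboolP h12 /asboolP h23; apply/asboolP => x.
  exact: le_trans (h12 x).
- move=> [p1 h1] [p2 h2] /asboolP h12 /asboolP h21; apply: eq_exist => /=.
  by apply/funext => x; apply/eqP; rewrite eq_le h21 h12.
- move=> A Atot; have [->|/set0P[s0 As0]] := eqVneq A set0.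
    by exists (exist _ q (conj sq (fun=> lexx _))).
  pose m x := inf [set sval s x | s in A].
  have lbA x : has_lbound [set sval s x | s in A].
    exists (- q (- x)) => _ [[s [ss sle]] /= As <-].
    by apply: le_trans (sublinear_geN _ ss); rewrite lerN2.
  have ms : sublinear m.
    apply: inf_sublinear => //.
    - by exists s0 => //; case: (s0) => s [ss sle] /=; rewrite sublinear0.
    - move=> i j x y Ai Aj; have [/asboolP ij|/asboolP ji] := Atot _ _ Ai Aj.
        exists j => //; apply: le_trans ((svalP j).1.1 _ _) _.
        by rewrite lerD2r.
      exists i => //; apply: le_trans ((svalP i).1.1 _ _) _.
      by rewrite lerD2l.
    - move=> i a x Ai a0; exists i => //.
      by apply: (svalP i).1.2; exact: ltW.
  have mle s x : A s -> m x <= sval s x by move=> As; apply: ge_inf => //; exists s.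
  have mq x : m x <= q x by apply: le_trans (mle _ _ As0) ((svalP s0).2 x).
  by exists (exist _ m (conj ms mq)) => s As; apply/asboolP => x; exact: mle.
exists (sval p); have [sp pq] := svalP p; split => // p' sp' pp'.
have p'q x : p' x <= q x by exact: le_trans (pp' x) (pq x).
have := pmin (exist _ p' (conj sp' p'q)) => <- //.
by apply/asboolP.
Qed.

(* Minimality of [p] is tested on [w |-> inf_(t >= 0) p (w + t v) - t p v]. *)
Lemma minimal_sublinear_additive (p : E -> R) : sublinear p ->
    (forall p', sublinear p' -> (forall x, p' x <= p x) -> p' = p) ->
  forall v w, p (w + v) = p w + p v.
Proof.
move=> sp pmin v w; apply/eqP; rewrite eq_le sp.1 /=.
pose F (t : R) w := p (w + t *: v) - t * p v.
pose A := [set t : R | 0 <= t].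
have Flb x : has_lbound [set F t x | t in A].
  exists (- p (- x)) => _ [t /= t0 <-]; rewrite /F.
  have := sp.1 (- x) (x + t *: v); rewrite addKr sublinearZ//; lra.
have A0 : A 0 by rewrite /A /=.
have Fle t x : A t -> inf [set F t x | t in A] <= F t x.
  by move=> At; apply: ge_inf; [exact: Flb|exists t].
have sF : sublinear (fun x => inf [set F t x | t in A]).
  apply: inf_sublinear => //.
  - by exists 0 => //; rewrite /F scale0r mul0r addr0 subr0 sublinear0.
  - move=> s t x y s0 t0; exists (s + t); first exact: addr_ge0.
    have := sp.1 (x + s *: v) (y + t *: v).
    by rewrite /F addrACA -scalerDl; lra.
  - move=> t a x t0 a0; exists (a * t); first by apply: mulr_ge0 => //; exact: ltW.
    have := sp.2 a (x + t *: v) (ltW a0).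
    by rewrite /F scalerDr scalerA; lra.
have <- := pmin _ sF; last first.
  by move=> x; apply: le_trans (Fle 0 x A0) _; rewrite /F scale0r mul0r addr0 subr0.
(* The infimum equals [p] by minimality; comparing it at [w] with the member [t = 1] gives
   [p w <= p (w + v) - p v]. *)
have := Fle 1 w; rewrite /A /= ler01 => /(_ isT).
have := Fle 0 v A0; have := Fle 0 (w + v) A0.
have FF : (fun x => inf [set F t x | t in A]) = p.
  apply: pmin => // x.
  by apply: le_trans (Fle 0 x A0) _; rewrite /F scale0r mul0r addr0 subr0.
have e y : inf [set F t y | t in A] = p y by have := congr1 (@^~ y) FF.
by rewrite !e /F scale1r mul1r; lra.
Qed.

(** A minimal sublinear function is additive, hence odd, and oddness extends its homogeneity to
    negative scalars. *)
Theorem hahn_banach_sublinear (q : E -> R) : sublinear q ->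
  exists2 g : E -> R^o, linear g & forall x, g x <= q x.
Proof.
move=> /minimal_sublinear[p [sp pq pmin]].
have pD v w : p (w + v) = p w + p v by exact: minimal_sublinear_additive.
have pN x : p (- x) = - p x.
  by have := pD (- x) x; rewrite subrr sublinear0//; lra.
exists p => // a x y; rewrite pD; congr (_ + _).
have [a0|a0] := leP 0 a; first exact: sublinearZ.
rewrite -[a]opprK scaleNr pN sublinearZ ?oppr_ge0 ?(ltW a0)//.
by rewrite scaleNr.
Qed.
End sublinear.

(** * Bounded and convex sets, bounded functionals *)

Section functionals.
Variables (R : realType) (E : normedModType R).

Lemma bounded_setP (A : set E) :
  bounded_set A <-> exists M : R, forall x, A x -> `|x| <= M.
Proof.
split=> [[M [_ /(_ (M + 1))]]|[M AM]].
  by rewrite ltrDl ltr01 => /(_ isT) h; exists (M + 1).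
exists M; split; first exact: num_real.
by move=> N MN x Ax /=; apply: le_trans (AM x Ax) _; exact: ltW.
Qed.

Lemma convex_set_combination (A : set E) (x y : E) (t : R) : convex_set A ->
  A x -> A y -> 0 <= t <= 1 -> A (t *: x + (1 - t) *: y).
Proof.
move=> cA Ax Ay /andP[t0 t1].
by have := cA x y (Itv01 t0 t1); rewrite !inE => /(_ Ax Ay).
Qed.

Lemma convex_set_intro (A : set E) :
  (forall (x y : E) (t : R), A x -> A y -> 0 <= t <= 1 ->
     A (t *: x + (1 - t) *: y)) -> convex_set A.
Proof.
move=> h x y t; rewrite !inE => Ax Ay; apply: h => //.
by apply/andP; split; [exact: ge0|exact: le1].
Qed.

Lemma dual_le_norm (f : dual E) (x : E) : `|f x| <= dual_norm f * `|x|.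
Proof.
have [->|x0] := eqVneq x 0; first by rewrite linear0 !normr0 mulr0.
have nx0 : 0 < `|x| by rewrite normr_gt0.
have : `|f (`|x|^-1 *: x)| <= dual_norm f.
  by rewrite dual_norm_ub// normrZ normfV normr_id mulVf// gt_eqF.
rewrite linearZ /= normrM normfV normr_id mulrC ler_pdivrMr//.
Qed.

Lemma linear_sub (g : E -> R^o) x y : linear g -> g (x - y) = g x - g y.
Proof.
move=> lg; have -> : x - y = (-1) *: y + x by rewrite scaleN1r addrC.
by rewrite lg scaleN1r addrC.
Qed.

Lemma bounded_linear_dual (g : E -> R^o) (M : R) :
  linear g -> (forall x, `|g x| <= M * `|x|) -> exists f : dual E, f = g :> (_ -> _).
Proof.
move=> lg gM; have cg : continuous g.
  move=> x; apply/cvgrPdist_le => /= e e0; apply/nbhs_normP.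
  have M0 : 0 < `|M| + 1 by rewrite ltr_wpDl.
  exists (e / (`|M| + 1)) => /=; first by rewrite divr_gt0.
  move=> y /= xy; rewrite -linear_sub//; apply: le_trans (gM _) _.
  have := ltW xy; rewrite ler_pdivlMr// mulrC; apply: le_trans.
  by rewrite ler_wpM2r// (le_trans (ler_norm _))// lerDl.
have gin : g \in is_functional (E := E) by rewrite inE.
by exists (Dual gin).
Qed.

End functionals.

(** * Separation and nested convex sets in reflexive spaces *)

Section weak_compactness.
Variables (R : realType) (E : normedModType R).

(* The functional is dominated by [v |-> inf_(t >= 0, k in K) |v - t (k - x)| - t d],
   where [d] is the distance from [x] to [K]. *)
Lemma separation (K : set E) (x : E) : K !=set0 -> closed K -> convex_set K ->
  ~ K x -> exists f : dual E, exists2 d : R, 0 < d &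
    forall k, K k -> f k <= f x - d.
Proof.
move=> [k0 Kk0] clK cK nKx.
have [d d0 Kd] : exists2 d : R, 0 < d & forall k, K k -> d <= `|k - x|.
  have : nbhs x (~` K) by apply: open_nbhs_nbhs; split => //; exact: closed_openC.
  move=> /nbhs_normP[d /= d0 dK]; exists d => // k Kk; rewrite leNgt.
  by apply/negP => kx; apply: (dK k) => //=; rewrite distrC.
pose A := [set ct : E * R | 0 <= ct.2 /\
  exists2 k, K k & ct.1 = ct.2 *: (k - x)].
pose F (ct : E * R) v := `|v - ct.1| - ct.2 * d.
have A0 : A (0, 0) by split => //=; exists k0 => //; rewrite scale0r.
have Flb v ct : A ct -> - `|v| <= F ct v.
  move: ct => [c t] [/= t0 [k Kk /= ->]]; rewrite /F/=.
  have : t * d <= t * `|k - x| by rewrite ler_wpM2l// Kd.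
  have := ler_normB v (v - t *: (k - x)).
  by rewrite subKr normrZ ger0_norm//; lra.
have Flb' v : has_lbound [set F ct v | ct in A].
  by exists (- `|v|) => _ [ct Act <-]; exact: Flb.
have sF : sublinear (fun v => inf [set F ct v | ct in A]).
  apply: inf_sublinear => //.
  - by exists (0, 0) => //; rewrite /F /= subr0 normr0 mul0r subr0.
  - move=> [_ t] [_ s] v w [/= t0 [k Kk /= ->]] [/= s0 [l Kl /= ->]].
    exists (t *: (k - x) + s *: (l - x), t + s); last first.
      rewrite /F /= opprD addrACA mulrDl.
      by have := ler_normD (v - t *: (k - x)) (w - s *: (l - x)); lra.
    split; first exact: addr_ge0.
    have [ts0|ts0] := eqVneq (t + s) 0.
      exists k => //=; rewrite ts0 scale0r.
      have -> : t = 0 by lra.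
      have -> : s = 0 by lra.
      by rewrite !scale0r addr0.
    have ts : 0 < t + s by rewrite lt_neqAle eq_sym ts0 addr_ge0.
    (* The weighted mean of [k] and [l] for which [t (k - x) + s (l - x)] is [t + s] times its
       difference from [x]. *)
    exists ((t / (t + s)) *: k + (1 - t / (t + s)) *: l).
      apply: convex_set_combination => //; rewrite divr_ge0 ?addr_ge0//=.
      by rewrite ler_pdivrMr// mul1r lerDl.
    have -> : 1 - t / (t + s) = s / (t + s) by field.
    rewrite /= [RHS]scalerBr [in RHS]scalerDr !scalerA.
    rewrite [_ * (t / _)]mulrC [_ * (s / _)]mulrC !divfK//.
    by rewrite !scalerBr scalerDl opprD addrACA.
  - move=> [_ t] a v [/= t0 [k Kk /= ->]] a0.
    exists (a *: (t *: (k - x)), a * t).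
      by split=> /=; [rewrite mulr_ge0// ltW|exists k => //; rewrite scalerA].
    by rewrite /F /= -scalerBr normrZ gtr0_norm// mulrBr mulrA.
have [g lg gF] := hahn_banach_sublinear sF.
have gle ct v : A ct -> g v <= F ct v.
  move=> Act; apply: le_trans (gF v) _; apply: ge_inf => //.
  by exists ct.
have gnorm v : g v <= `|v|.
  by apply: le_trans (gle _ _ A0) _; rewrite /F /= subr0 mul0r subr0.
have gB v w : g (v - w) = g v - g w by exact: linear_sub.
have gN v : g (- v) = - g v.
  by have := gB v v; have := gB 0 v; rewrite sub0r subrr; lra.
have [|f fg] := @bounded_linear_dual _ _ g 1 lg.
  by move=> v; rewrite mul1r ler_norml gnorm andbT lerNl -gN -(normrN v) gnorm.
exists f => //; exists d => // k Kk; rewrite fg.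
(* At [v = k - x] the member with [t = 1] has vanishing norm term, so the gauge there is at most
   [- d]. *)
have Ak : A (k - x, 1) by split=> //=; exists k; rewrite ?scale1r.
by have := gle (k - x, 1) (k - x) Ak; rewrite /F /= subrr normr0 gB mul1r; lra.
Qed.

(** Compactness of [[- M, M]] supplies a cluster point, and an ultrafilter converges to each of its
    cluster points. *)
Lemma ultra_cvg_segment (U : set_system nat) (v : nat -> R) (M : R) :
  UltraFilter U -> (forall n, `|v n| <= M) -> cvg (v n @[n --> U]).
Proof.
move=> UU vM.
have [|c [_ clc]] := @segment_compact R (- M) M (v @ U) _.
  by apply: nearW => n /=; rewrite in_itv /= -ler_norml; exact: vM.
apply/cvg_ex; exists c => B cB /=.
have [//|UC] := @in_ultra_setVsetC _ _ (v @^-1` B) UU.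
have [r [/= nBr Br]] := clc (~` B) B UC cB.
by [].
Qed.

(** Choose [x n] in [K n]. The limits of [f (x n)] along a free ultrafilter form a bounded
    functional of [f]; reflexivity represents it by a point [y], and a functional separating [y]
    from some [K n] would contradict this limit. *)
Theorem reflexive_nested_bigcap (K : nat -> set E) : reflexive_space E ->
  (forall n, K n !=set0) -> (forall n, closed (K n)) ->
  (forall n, convex_set (K n)) -> bounded_set (K 0%N) ->
  (forall n, K n.+1 `<=` K n) -> exists x, forall n, K n x.
Proof.
move=> Erefl K0 Kcl Kcv Kbd Kdec.
have Kle n m : (n <= m)%N -> K m `<=` K n.
  elim: m => [|m IH]; first by rewrite leqn0 => /eqP->.
  by rewrite leq_eqVlt => /predU1P[->//|/IH]; apply: subset_trans.
have [x Kx] := choice K0.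
have [M xM] : exists M, forall n, `|x n| <= M.
  have /bounded_setP[M KM] := Kbd; exists M => n.
  by apply: KM; exact: (Kle 0%N n).
have M0 : 0 <= M by exact: le_trans (xM 0%N).
have [U [UU sU]] := ultraFilterLemma eventually_filter.
have fM (f : dual E) n : `|f (x n)| <= dual_norm f * M.
  apply: le_trans (dual_le_norm _ _) _; rewrite ler_wpM2l//.
  exact: normr_ge0 f.
have fcvg (f : dual E) : cvg (f (x n) @[n --> U]).
  exact: ultra_cvg_segment (fM f).
pose Phi (f : dual E) : R^o := lim (f (x n) @[n --> U]).
have Phi_lin : linear Phi.
  move=> a f g; apply: cvg_lim => //.
  change ((fun n => a * f (x n) + g (x n)) @ U --> a * Phi f + Phi g).
  by apply: cvgD (fcvg g); apply: cvgM (fcvg f); exact: cvg_cst.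
have PhiM f : `|Phi f| <= M * `|f|.
  rewrite mulrC ler_norml; apply/andP; split.
    apply: limr_ge => //; apply: nearW => n.
    by have := fM f n; rewrite ler_norml => /andP[].
  apply: limr_le => //; apply: nearW => n.
  by have := fM f n; rewrite ler_norml => /andP[].
have [P PE] := bounded_linear_dual Phi_lin PhiM.
have [y yE] := Erefl P.
exists y => n; apply: contrapT => nKy.
have [f [d d0 fd]] := separation (K0 n) (Kcl n) (Kcv n) nKy.
have : Phi f <= f y - d.
  apply: limr_le => //; apply: sU; exists n => // m /= nm.
  by apply: fd; apply: Kle (Kx m).
by rewrite -PE yE; lra.
Qed.
End weak_compactness.

(** * The normalized duality map *)

Section uniform_duality_map.
Variables (R : realType) (E : normedModType R).

(* [j x] is the normalized duality map at [x], i.e. half the differential of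
   [|.|^2], the derivative being uniform for [x] in bounded sets. *)
Definition uniform_duality_map (j : E -> E -> R) := forall (M : R) (y : E) (e : R),
  0 < e -> exists2 d : R, 0 < d & forall x t, `|x| <= M -> `|t| <= d ->
    `| `|x + t *: y| ^+ 2 - `|x| ^+ 2 - 2 * t * j x y| <= e * `|t|.

(** The uniform limit of difference quotients, multiplied out so that [t = 0] is no exception. *)
Definition sphere_differential (g : E -> R) (y : E) := forall e : R, 0 < e ->
  exists2 d : R, 0 < d & forall (x : E) (t : R), `|x| = 1 -> `|t| <= d ->
    `| `|x + t *: y| - 1 - t * g x| <= e * `|t|.

(** The hypothesis concerns unit directions; a nonzero [y] reduces to [y / |y|] with parameter
    [t * |y|]. *)
Lemma uGd_sphere_differential : uniformly_Gateaux_differentiable_norm E ->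
  forall y, exists g, sphere_differential g y.
Proof.
move=> uGd y; have [->|y0] := eqVneq y 0.
  exists (fun=> 0) => e e0; exists 1 => // x t x1 _.
  by rewrite scaler0 addr0 x1 mulr0 subrr subr0 normr0 mulr_ge0// ltW.
have ny0 : 0 < `|y| by rewrite normr_gt0.
have [|L Lc] := uGd (`|y|^-1 *: y).
  by rewrite /unit_sphere /= normrZ normfV normr_id mulVf ?gt_eqF.
exists (fun x => `|y| * L x) => e e0.
pose W := [set h : E -> R | forall x, unit_sphere x -> `|L x - h x| <= e / `|y|].
have : \forall t \near (0 : R)^',
    W (fun x => (`|x + t *: (`|y|^-1 *: y)| - `|x|) / t).
  apply: (Lc W); apply/uniform_nbhs.
  exists [set xy : R * R | `|xy.1 - xy.2| < e / `|y|]; split.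
    by rewrite -entourage_ballE; exists (e / `|y|) => //=; exact: divr_gt0.
  by move=> h /= hL x x1; apply/ltW/hL.
move=> /nbhs_normP[d /= d0 dW]; exists (d / 2 / `|y|); first by rewrite !divr_gt0.
move=> x t x1; rewrite ler_pdivlMr// => td.
have [->|t0] := eqVneq t 0.
  by rewrite scale0r addr0 x1 mul0r subrr subr0 normr0 mulr0.
have ty0 : t * `|y| != 0 by rewrite mulf_neq0// gt_eqF.
have := dW (t * `|y|); rewrite /= sub0r normrN normrM normr_id.
have td' : `|t| * `|y| < d by lra.
move=> /(_ td' ty0 x x1) /=.
rewrite scalerA mulfK ?gt_eqF// x1.
have -> : L x - (`|x + t *: y| - 1) / (t * `|y|) =
  - (`|x + t *: y| - 1 - t * (`|y| * L x)) / (t * `|y|).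
  by field; rewrite t0 gt_eqF.
rewrite normrM normrN normfV normrM normr_id ler_pdivrMr; last first.
  by rewrite mulr_gt0// normr_gt0.
by rewrite [leRHS]mulrCA divfK ?gt_eqF// [leRHS]mulrC.
Qed.

Lemma sphere_differential_le g y x : sphere_differential g y -> `|x| = 1 ->
  `|g x| <= `|y|.
Proof.
move=> gy x1; apply/ler_addgt0Pr => e e0.
have [d d0 /(_ x d x1)] := gy e e0.
rewrite (gtr0_norm d0) lexx => /(_ isT) h.
have := ler_normD x (d *: y); have := ler_normB (x + d *: y) (d *: y).
rewrite addrK normrZ (gtr0_norm d0) x1 => h1 h2.
move: h; rewrite ler_norml => /andP[h3 h4].
rewrite -(ler_pM2l d0); rewrite -[X in X * `|_|](gtr0_norm d0) -normrM ler_norml.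
apply/andP; split; lra.
Qed.

(** By the chain rule [j x y] is [|x|] times the differential of the norm at [x / |x|]. The rescaled
    parameter [t / |x|] is controlled only away from [x = 0]; for [|x| <= h] every term is small by
    itself. *)
Theorem uGd_duality_map : uniformly_Gateaux_differentiable_norm E ->
  exists j, uniform_duality_map j.
Proof.
move=> /uGd_sphere_differential/choice[g gP].
exists (fun x y => `|x| * g y (`|x|^-1 *: x)) => M y e e0.
have gle x : x != 0 -> `|g y (`|x|^-1 *: x)| <= `|y|.
  move=> x0; apply: sphere_differential_le (gP y) _.
  by rewrite normrZ normfV normr_id mulVf// normr_eq0.
have key c a : 0 < c -> 0 <= a -> e / (c * (a + 1)) * a <= e / c.
  move=> c0 a0; have a1 : 0 < a + 1 by rewrite ltr_wpDl.
  have -> : e / (c * (a + 1)) * a = e / c * (a / (a + 1)).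
    by field; rewrite !gt_eqF.
  rewrite ler_piMr ?divr_ge0 ?(ltW e0) ?(ltW c0)//.
  by rewrite ler_pdivrMr// mul1r lerDl.
have y1 : 0 < `|y| + 1 by rewrite ltr_wpDl.
pose h := e / (8 * (`|y| + 1)).
have h0 : 0 < h by rewrite divr_gt0// mulr_gt0.
have hy : h * `|y| <= e / 8 by apply: (key).
pose e' := e / (4 * (`|M| + 1)).
have M1 : 0 < `|M| + 1 by rewrite ltr_wpDl.
have e'0 : 0 < e' by rewrite divr_gt0// mulr_gt0.
have e'M : e' * `|M| <= e / 4 by apply: (key); rewrite ?exprn_ge0.
have [d d0 dP] := gP y e' e'0.
pose k := e / (4 * (`|y| ^+ 2 + 1)).
have y21 : 0 < `|y| ^+ 2 + 1 by rewrite ltr_wpDl// exprn_ge0.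
have k0 : 0 < k by rewrite divr_gt0// mulr_gt0.
have ky : k * `|y| ^+ 2 <= e / 4 by apply: (key); rewrite ?exprn_ge0.
(* [d * h] keeps [t / |x|] below [d] when [|x| > h]; [k] bounds the second-order term [(A - r) ^+ 2]
   by [e / 4 * |t|]. *)
exists (Num.min (d * h) k); first by rewrite lt_min k0 mulr_gt0.
move=> x t xM; rewrite le_min => /andP[td tk].
have := lerB_dist (x + t *: y) x; rewrite addrAC subrr add0r normrZ.
have := lerB_dist x (x + t *: y); rewrite opprD addNKr normrN normrZ.
set A := `|x + t *: y|; set r := `|x| => Ar1 Ar2.
have A0 : 0 <= A := normr_ge0 _; have r0 : 0 <= r := normr_ge0 _.
have ArD : `|A - r| <= `|t| * `|y| by rewrite ler_norml; apply/andP; split; lra.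
have Ar2' : (A - r) ^+ 2 <= e / 4 * `|t|.
  rewrite -real_normK ?num_real//.
  apply: le_trans (_ : (`|t| * `|y|) ^+ 2 <= _).
    by rewrite lerXn2r// nnegrE// mulr_ge0.
  apply: le_trans (_ : (k * `|y| ^+ 2) * `|t| <= _); last by rewrite ler_wpM2r.
  rewrite exprMn expr2 -mulrA mulrC; apply: ler_wpM2r => //.
  by rewrite ler_wpM2r// exprn_ge0.
have [rh|hr] := leP r h.
  have rAr : `|r * (A - r)| <= e / 8 * `|t|.
    rewrite normrM (ger0_norm r0).
    apply: le_trans (_ : h * (`|t| * `|y|) <= _); first exact: ler_pM.
    by rewrite mulrCA mulrC ler_wpM2r.
  have tj : `|t * (r * g y (r^-1 *: x))| <= e / 8 * `|t|.
    rewrite normrM mulrC ler_wpM2r// normrM (ger0_norm r0).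
    have [x0|x0] := eqVneq x 0; first by rewrite /r x0 normr0 mul0r; lra.
    apply: le_trans hy; apply: ler_pM => //; exact: gle.
  have eq : A ^+ 2 - r ^+ 2 - 2 * t * (r * g y (r^-1 *: x)) =
    2 * (r * (A - r)) + (A - r) ^+ 2 - 2 * (t * (r * g y (r^-1 *: x))) by ring.
  rewrite eq; move: rAr tj; rewrite !ler_norml => /andP[? ?] /andP[? ?].
  have := sqr_ge0 (A - r).
  by move=> ?; apply/andP; split; lra.
have rgt0 : 0 < r by exact: lt_trans hr.
have trd : `|t / r| <= d.
  rewrite normrM normfV (gtr0_norm rgt0) ler_pdivrMr//; apply: le_trans td _.
  by rewrite ler_pM2l// ltW.
have /dP/(_ trd) : `|r^-1 *: x| = 1.
  by rewrite normrZ normfV normr_id mulVf// gt_eqF.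
have -> : `|r^-1 *: x + (t / r) *: y| = A / r.
  rewrite [t / r]mulrC -scalerA -scalerDr normrZ normfV (gtr0_norm rgt0).
  by rewrite mulrC.
have -> : A / r - 1 - t / r * g y (r^-1 *: x) = (A - r - t * g y (r^-1 *: x)) / r.
  by field; rewrite gt_eqF.
rewrite !normrM normfV (gtr0_norm rgt0) mulrA ler_pM2r ?invr_gt0// => h1.
have rM : r <= `|M| by apply: le_trans xM (ler_norm _).
have h2 : `|r * (A - r - t * g y (r^-1 *: x))| <= e / 4 * `|t|.
  rewrite normrM (ger0_norm r0).
  apply: le_trans (_ : `|M| * (e' * `|t|) <= _); first exact: ler_pM.
  by rewrite mulrA ler_wpM2r// mulrC.
have -> : A ^+ 2 - r ^+ 2 - 2 * t * (r * g y (r^-1 *: x)) =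
  2 * (r * (A - r - t * g y (r^-1 *: x))) + (A - r) ^+ 2 by ring.
move: h2; rewrite !ler_norml => /andP[? ?]; have := sqr_ge0 (A - r).
by move=> ?; apply/andP; split; lra.
Qed.
End uniform_duality_map.

(** * Algebraic rules, bounds and continuity of the duality map *)

Section duality_map_properties.
Variables (R : realType) (E : normedModType R) (j : E -> E -> R).
Hypothesis jP : uniform_duality_map j.
Implicit Types x y z : E.

(** A right derivative already determines [j x y]; this transfers scalings and signs to [j]. *)
Lemma duality_map_unique x y (c : R) :
    (forall e : R, 0 < e -> exists2 d : R, 0 < d & forall t : R, 0 < t -> t <= d ->
      `| `|x + t *: y| ^+ 2 - `|x| ^+ 2 - 2 * t * c| <= e * t) ->
  j x y = c.
Proof.
move=> h; apply/eqP; rewrite -subr_eq0 -normr_le0.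
apply/ler_addgt0Pr => e e0; rewrite add0r.
have [d1 d10 h1] := h e e0; have [d2 d20 h2] := jP `|x| y e0.
pose t := Num.min d1 d2.
have t0 : 0 < t by rewrite lt_min d10.
have td1 : t <= d1 by rewrite ge_min lexx.
have td2 : `|t| <= d2 by rewrite gtr0_norm// ge_min lexx orbT.
have := h1 t t0 td1; have := h2 x t (lexx _) td2.
rewrite (gtr0_norm t0) !ler_norml => /andP[? ?] /andP[? ?].
by apply/andP; split; rewrite -(ler_pM2l t0); lra.
Qed.

(** Divide by [t] and let [t] tend to [0]: the quadratic term disappears. Bounds on [j] thus reduce
    to bounds on [|x + t y| ^+ 2]. *)
Lemma duality_map_le_slope x y (b k : R) : 0 <= k ->
    (forall t : R, 0 < t -> t <= 1 ->
      `|x + t *: y| ^+ 2 - `|x| ^+ 2 <= t * b + k * t ^+ 2) ->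
  2 * j x y <= b.
Proof.
move=> k0 h; apply/ler_addgt0Pr => e e0.
have e20 : 0 < e / 2 by rewrite divr_gt0.
have [d d0 hd] := jP `|x| y e20.
have k1 : 0 < k + 1 by rewrite ltr_wpDl.
pose t := Num.min (Num.min d 1) (e / 2 / (k + 1)).
have t0 : 0 < t by rewrite !lt_min d0 ltr01 divr_gt0.
have td : `|t| <= d by rewrite gtr0_norm// !ge_min lexx.
have t1 : t <= 1 by rewrite !ge_min lexx orbT.
have : t <= e / 2 / (k + 1) by rewrite ge_min lexx orbT.
rewrite ler_pdivlMr// => tk.
have := h t t0 t1; have := hd x t (lexx _) td.
rewrite (gtr0_norm t0) ler_norml => /andP[h1 _] h2.
rewrite -(ler_pM2l t0).
have : t * (t * (k + 1)) <= t * (e / 2) by rewrite ler_pM2l.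
by have := sqr_ge0 t; lra.
Qed.

Lemma duality_map_le x y : j x y <= `|x| * `|y|.
Proof.
suff : 2 * j x y <= 2 * (`|x| * `|y|) by rewrite ler_pM2l.
apply: (@duality_map_le_slope _ _ _ (`|y| ^+ 2)); first exact: exprn_ge0.
move=> t t0 _.
have : `|x + t *: y| ^+ 2 <= (`|x| + t * `|y|) ^+ 2.
  rewrite lerXn2r ?nnegrE ?addr_ge0 ?mulr_ge0 ?(ltW t0)//.
  by apply: le_trans (ler_normD _ _) _; rewrite normrZ gtr0_norm.
by lra.
Qed.

(** The squared norm is convex on the segment from [x] to [x + y], so its initial slope is at most
    its increment. *)
Lemma duality_map_subgradient x y : `|x| ^+ 2 + 2 * j x y <= `|x + y| ^+ 2.
Proof.
suff : 2 * j x y <= `|x + y| ^+ 2 - `|x| ^+ 2 by lra.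
apply: (@duality_map_le_slope _ _ _ 0) => // t t0 t1.
have -> : x + t *: y = (1 - t) *: x + t *: (x + y).
  by rewrite scalerDr addrA -scalerDl subrK scale1r.
have := ler_normD ((1 - t) *: x) (t *: (x + y)).
rewrite !normrZ (gtr0_norm t0) ger0_norm ?subr_ge0//.
set a := `|_ + _| => h.
have a0 : 0 <= a := normr_ge0 _.
have : a ^+ 2 <= ((1 - t) * `|x| + t * `|x + y|) ^+ 2.
  by rewrite lerXn2r// nnegrE addr_ge0// mulr_ge0// ?subr_ge0// ltW.
have : 0 <= t * (1 - t) * (`|x| - `|x + y|) ^+ 2.
  by rewrite mulr_ge0 ?sqr_ge0// mulr_ge0 ?subr_ge0// ltW.
by lra.
Qed.

Lemma duality_mapZr x a y : j x (a *: y) = a * j x y.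
Proof.
apply: duality_map_unique => e e0.
have a1 : 0 < `|a| + 1 by rewrite ltr_wpDl.
have ea : 0 < e / (`|a| + 1) by exact: divr_gt0.
have [d d0 hd] := jP `|x| y ea.
exists (d / (`|a| + 1)) => [|t t0 td]; first exact: divr_gt0.
have ta : `|t * a| <= d.
  move: td; rewrite ler_pdivlMr// normrM gtr0_norm//; lra.
have := hd x _ (lexx _) ta.
rewrite scalerA; have -> : 2 * t * (a * j x y) = 2 * (t * a) * j x y by ring.
move=> h; apply: le_trans h _; rewrite normrM gtr0_norm// mulrCA (mulrC e t).
rewrite ler_pM2l// mulrAC ler_pdivrMr//.
by rewrite ler_pM2l// lerDl.
Qed.

Lemma duality_mapNr x y : j x (- y) = - j x y.
Proof. by rewrite -scaleN1r duality_mapZr mulN1r. Qed.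

Lemma duality_map0r x : j x 0 = 0.
Proof. by rewrite -(scale0r 0) duality_mapZr mul0r. Qed.

Lemma duality_mapNl x y : j (- x) y = - j x y.
Proof.
rewrite -duality_mapNr; apply: duality_map_unique => e e0.
have [d d0 hd] := jP `|x| (- y) e0.
exists d => // t t0 td; have := hd x t (lexx _).
rewrite scalerN normrN [- x + _]addrC -[t *: y - x]opprB normrN gtr0_norm//.
exact.
Qed.

(** As [j x] is odd, subadditivity suffices. It follows from midpoint convexity of the squared norm,
    [x + t (y + z)] being the midpoint of [x + 2 t y] and [x + 2 t z]. *)
Lemma duality_mapDr x y z : j x (y + z) = j x y + j x z.
Proof.
suff jD u v : j x (u + v) <= j x u + j x v.
  apply/eqP; rewrite eq_le jD /=; have := jD (- y) (- z).
  by rewrite -opprD !duality_mapNr; lra.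
apply/ler_addgt0Pr => e e0; have e30 : 0 < e / 2 by rewrite divr_gt0.
have [d1 d10 h1] := jP `|x| u e30.
have [d2 d20 h2] := jP `|x| v e30.
have [d3 d30 h3] := jP `|x| (u + v) e30.
pose t := Num.min (Num.min d1 d2) d3 / 2.
have t0 : 0 < t by rewrite divr_gt0// !lt_min d10 d20.
have [td1 td2 td3] : [/\ 2 * t <= d1, 2 * t <= d2 & 2 * t <= d3].
  by rewrite /t mulrC divfK//; split; rewrite !ge_min lexx ?orbT.
clearbody t; have t20 : 0 < 2 * t by rewrite mulr_gt0.
have td3' : t <= d3 by lra.
have := h1 x (2 * t) (lexx _); have := h2 x (2 * t) (lexx _).
have := h3 x t (lexx _); rewrite (gtr0_norm t0) (gtr0_norm t20).
move=> /(_ td3') + /(_ td2) + /(_ td1).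
rewrite !ler_norml => /andP[h3' _] /andP[_ h2'] /andP[_ h1'].
have par : 2 * `|x + t *: (u + v)| ^+ 2 <=
    `|x + (2 * t) *: u| ^+ 2 + `|x + (2 * t) *: v| ^+ 2.
  have : `|x + t *: (u + v)| *+ 2 <= `|x + (2 * t) *: u| + `|x + (2 * t) *: v|.
    rewrite -normrMn; apply: le_trans (ler_normD _ _).
    by rewrite addrACA -mulr2n -scalerDr -scalerA scaler_nat -mulrnDl.
  set a := `|_ + _|; set b := `|_ + _|; set c := `|_ + _| => abc.
  have [a0 b0 c0] : [/\ 0 <= a, 0 <= b & 0 <= c] by split; exact: normr_ge0.
  have : (a *+ 2) ^+ 2 <= (b + c) ^+ 2.
    by rewrite lerXn2r// nnegrE ?mulrn_wge0// addr_ge0.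
  by rewrite mulr2n; have := sqr_ge0 (b - c); lra.
by have := mulr_gt0 e0 t0; rewrite -(ler_pM2l t20); lra.
Qed.

Lemma duality_mapBr x y z : j x (y - z) = j x y - j x z.
Proof. by rewrite duality_mapDr duality_mapNr. Qed.

Lemma duality_map_self x : j x x = `|x| ^+ 2.
Proof.
have q (t : R) : `|t| <= 1 ->
    `|x + t *: x| ^+ 2 - `|x| ^+ 2 = 2 * t * `|x| ^+ 2 + `|x| ^+ 2 * t ^+ 2.
  move=> t1; rewrite -{1}[x]scale1r -scalerDl normrZ exprMn real_normK ?num_real//.
  by ring.
apply/eqP; rewrite eq_le; apply/andP; split.
  suff : 2 * j x x <= 2 * `|x| ^+ 2 by rewrite ler_pM2l.
  apply: (@duality_map_le_slope _ _ _ (`|x| ^+ 2)); first exact: exprn_ge0.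
  by move=> t t0 t1; rewrite q ?gtr0_norm//; lra.
suff : 2 * j x (- x) <= - 2 * `|x| ^+ 2 by rewrite duality_mapNr; lra.
apply: (@duality_map_le_slope _ _ _ (`|x| ^+ 2)); first exact: exprn_ge0.
move=> t t0 t1; rewrite scalerN -scaleNr q// ?normrN ?gtr0_norm// sqrrN; lra.
Qed.

(** For one fixed small [t], [j x y] is uniformly close to a difference quotient, which is Lipschitz
    in [x] on bounded sets. *)
Lemma duality_map_unif_continuous (M : R) y (e : R) : 0 < e ->
  exists2 d : R, 0 < d & forall x x', `|x| <= M -> `|x'| <= M -> `|x - x'| <= d ->
    `|j x y - j x' y| <= e.
Proof.
move=> e0; have e20 : 0 < e / 2 by rewrite divr_gt0.
have [t t0 ht] := jP M y e20.
have Mt : 0 < 4 * `|M| + 2 * t * `|y| + 1.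
  by rewrite ltr_wpDl// addr_ge0// mulr_ge0// mulr_ge0// ltW.
exists (e * t / (4 * `|M| + 2 * t * `|y| + 1)) => [|x x' xM x'M].
  by rewrite divr_gt0// mulr_gt0.
rewrite ler_pdivlMr// => xx'.
have tt : `|t| <= t by rewrite gtr0_norm.
have := ht x t xM tt; have := ht x' t x'M tt; rewrite (gtr0_norm t0).
have sqB (a b : E) : `| `|a| ^+ 2 - `|b| ^+ 2| <= `|a - b| * (`|a| + `|b|).
  rewrite subr_sqr normrM (ger0_norm (addr_ge0 (normr_ge0 a) (normr_ge0 b))).
  by apply: ler_wpM2r; [exact: addr_ge0|exact: ler_dist_dist].
have := sqB x x'; have := sqB (x + t *: y) (x' + t *: y).
rewrite opprD addrACA subrr addr0.
have := ler_normD x (t *: y); have := ler_normD x' (t *: y).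
rewrite normrZ (gtr0_norm t0).
have MM := ler_norm M.
have xx0 := normr_ge0 (x - x').
set a := `|x + _|; set b := `|x' + _| => hb ha.
have h1 : `|x - x'| * (a + b) <= `|x - x'| * (2 * `|M| + 2 * t * `|y|).
  by rewrite ler_wpM2l//; lra.
have h2 : `|x - x'| * (`|x| + `|x'|) <= `|x - x'| * (2 * `|M|).
  by rewrite ler_wpM2l//; lra.
rewrite !ler_norml => /andP[? ?] /andP[? ?] /andP[? ?] /andP[? ?].
by apply/andP; split; rewrite -(ler_pM2l t0); nra.
Qed.
End duality_map_properties.

(** * The approximating path *)

Lemma sub_convex_combination (R : pzRingType) (V : lmodType R) (t : R) (a x y : V) :
  a - (t *: x + (1 - t) *: y) = t *: (a - x) + (1 - t) *: (a - y).
Proof.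
by rewrite !scalerBr addrACA -scalerDl [t + _]addrC subrK scale1r opprD.
Qed.

Section asymptotic_center.
Variables (R : realType) (E : normedModType R) (C : set E) (z : nat -> E).
Hypotheses (C_neq0 : C !=set0) (C_closed : closed C) (C_convex : convex_set C).

(* The points [y] of [C] with [limsup |z n - y| <= r]. *)
Definition asymptotic_ball (r : R) : set E := [set y | C y /\
  forall e : R, 0 < e -> exists N, forall n, (N <= n)%N -> `|z n - y| <= r + e].

Lemma asymptotic_ball_le (r s : R) : r <= s -> asymptotic_ball r `<=` asymptotic_ball s.
Proof.
move=> rs y [Cy ry]; split => // e e0; have [N hN] := ry e e0.
by exists N => n /hN /le_trans; apply; rewrite lerD2r.
Qed.

Lemma asymptotic_ball_ge0 r y : asymptotic_ball r y -> 0 <= r.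
Proof.
move=> [_ ry]; apply/ler_addgt0Pr => e e0; have [N hN] := ry e e0.
exact: le_trans (normr_ge0 _) (hN N (leqnn N)).
Qed.

Lemma asymptotic_ball_closed r : closed (asymptotic_ball r).
Proof.
move=> y cly; split.
  apply: C_closed => B /cly[x [[Cx _] Bx]]; by exists x.
move=> e e0; have e20 : 0 < e / 2 by rewrite divr_gt0.
have /cly[x [[_ rx] /= yx]] := nbhsx_ballx y (e / 2) e20.
have [N hN] := rx _ e20; exists N => n /hN nx.
have := ler_distD x (z n) y; rewrite -ball_normE /= in yx.
by rewrite distrC in yx; lra.
Qed.

Lemma asymptotic_ball_convex r : convex_set (asymptotic_ball r).
Proof.
apply: convex_set_intro => x y t [Cx rx] [Cy ry] /andP[t0 t1]; split.
  by apply: convex_set_combination => //; rewrite t0.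
move=> e e0; have [N hN] := rx e e0; have [P hP] := ry e e0.
exists (maxn N P) => n; rewrite geq_max => /andP[/hN nx /hP ny].
rewrite sub_convex_combination; apply: le_trans (ler_normD _ _) _.
rewrite !normrZ ger0_norm// ger0_norm ?subr_ge0//.
have -> : r + e = t * (r + e) + (1 - t) * (r + e) by ring.
by apply: lerD; apply: ler_wpM2l; rewrite ?subr_ge0.
Qed.

Lemma asymptotic_ball_bounded (M r : R) : (forall n, `|z n| <= M) ->
  bounded_set (asymptotic_ball r).
Proof.
move=> zM; apply/bounded_setP; exists (M + r + 1) => y [_ /(_ 1 ltr01)[N hN]].
have := hN N (leqnn N); have := zM N; have := ler_normB (z N) (z N - y).
by rewrite subKr; lra.
Qed.

(** The infimum of the admissible radii is attained: the balls of radius [inf S + 1 / (n + 1)] are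
    nested, so reflexivity gives a common point. *)
Lemma asymptotic_center (M : R) : reflexive_space E -> (forall n, `|z n| <= M) ->
  exists r, asymptotic_ball r !=set0 /\
    forall s, asymptotic_ball s !=set0 -> r <= s.
Proof.
move=> Erefl zM; have [y0 Cy0] := C_neq0.
pose S := [set s : R | asymptotic_ball s !=set0].
have S0 : S !=set0.
  exists (M + `|y0|), y0; split => // e e0; exists 0%N => n _.
  by have := ler_normB (z n) y0; have := zM n; lra.
have Slb : has_lbound S by exists 0 => s [y]; exact: asymptotic_ball_ge0.
exists (inf S); split; last by move=> s; exact: ge_inf.
pose K n := asymptotic_ball (inf S + n.+1%:R^-1).
have [] := @reflexive_nested_bigcap _ _ K Erefl.
- move=> n; have n0 : 0 < n.+1%:R^-1 :> R by rewrite invr_gt0 ltr0Sn.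
  have [s [y sy] /ltW sle] := inf_adherent n0 (conj S0 Slb).
  by exists y; exact: asymptotic_ball_le sle _ sy.
- by move=> n; exact: asymptotic_ball_closed.
- by move=> n; exact: asymptotic_ball_convex.
- exact: asymptotic_ball_bounded zM.
- move=> n; apply: asymptotic_ball_le; rewrite lerD2l lef_pV2 ?posrE ?ltr0Sn//.
  by rewrite ler_nat.
move=> y Ky; exists y; split; first by have [] := Ky 0%N.
move=> e e0; have e20 : 0 < e / 2 by rewrite divr_gt0.
have [n ne] : exists n, n.+1%:R^-1 <= e / 2.
  exists (Num.truncn (e / 2)^-1); rewrite -[leRHS]invrK lef_pV2 ?posrE ?invr_gt0//.
  by apply/ltW/truncnS_gt.
have [_ /(_ _ e20)[N hN]] := Ky n; exists N => m /hN /le_trans; apply.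
by rewrite -addrA lerD2l [leRHS]splitr lerD2r.
Qed.
End asymptotic_center.

(** * Existence, estimates and strong clustering of the path *)

Section approximating_path.
Variables (R : realType) (E : completeNormedModType R).
Variables (j : E -> E -> R) (jP : uniform_duality_map j).
Variables (C : set E) (C_closed : closed C) (C_convex : convex_set C).
Variables (T : E -> E) (T_self : set_fun C C T) (T_ne : nonexpansive C T).
Variables (u : E) (Cu : C u).

Definition approximating_path (t : R) (z : E) :=
  [/\ 0 < t <= 1, C z & z = t *: u + (1 - t) *: T z].

(** [y |-> t u + (1 - t) T y] contracts the closed set [C] with constant [1 - t]. *)
Lemma approximating_path_exists (t : R) : 0 < t <= 1 -> exists z, approximating_path t z.
Proof.
move=> t01; have [t0 t1] := andP t01.
pose f y := t *: u + (1 - t) *: T y.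
have fC : set_fun C C f.
  by move=> y Cy; apply: convex_set_combination => //; [exact: T_self|rewrite ltW].
pose g : {fun C >-> C} := mkfun fC.
have t10 : 0 <= 1 - t by rewrite subr_ge0.
have [|//||z Cz zE] := @banach_fixed_point _ _ C g; last by exists z.
- exists (NngNum t10); split=> /=; first by rewrite ltrBlDr ltrDl.
  move=> [x y] [/= Cx Cy]; rewrite opprD addrACA subrr add0r -scalerBr normrZ.
  by rewrite ger0_norm// ler_wpM2l// T_ne.
- by exists u.
Qed.

(** The path equation reads [t (u - z) = (1 - t) (z - T z)]. In [z - T z = (z - y) + (y - T y) + (T
    y - T z)] the outer terms contribute at most [0] since [T] is nonexpansive. *)
Lemma approximating_path_le (t e : R) z y : approximating_path t z -> C y ->
  `|y - T y| <= e -> t * j (y - z) (u - z) <= (1 - t) * (e * `|y - z|).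
Proof.
move=> [/andP[t0 t1] Cz zE] Cy ye.
have -> : t * j (y - z) (u - z) = (1 - t) * j (y - z) (z - T z).
  rewrite -!(duality_mapZr jP); congr (j _ _).
  have := sub_convex_combination t z u (T z); rewrite -zE subrr => /esym/eqP.
  by rewrite addr_eq0 -[u - z]opprB scalerN => /eqP ->; rewrite opprK.
apply: ler_wpM2l; first by rewrite subr_ge0.
have -> : z - T z = (z - y) + (y - T y) + (T y - T z).
  by rewrite !subrKA.
rewrite -[z - y]opprB 2!(duality_mapDr jP) (duality_mapNr jP) (duality_map_self jP).
have h1 : j (y - z) (y - T y) <= e * `|y - z|.
  by apply: le_trans (duality_map_le jP _ _) _; rewrite mulrC ler_wpM2r.
have h2 : j (y - z) (T y - T z) <= `|y - z| ^+ 2.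
  by apply: le_trans (duality_map_le jP _ _) _; rewrite expr2 ler_wpM2l// T_ne.
by lra.
Qed.

Lemma approximating_path_bounded (t : R) z w : approximating_path t z ->
  fixed_points C T w -> `|z - w| <= `|u - w|.
Proof.
move=> [/andP[t0 t1] Cz zE] [Cw Tw].
rewrite distrC (distrC u).
have : `|w - z| <= t * `|w - u| + (1 - t) * `|w - z|.
  rewrite {1}zE sub_convex_combination.
  apply: le_trans (ler_normD _ _) _; rewrite !normrZ gtr0_norm// ger0_norm ?subr_ge0//.
  by rewrite lerD2l ler_wpM2l ?subr_ge0// -{1}Tw T_ne.
by move=> h; rewrite -(ler_pM2l t0); lra.
Qed.

(** The preceding estimate with [e = 0] gives [j (z - p) (u - z) >= 0]; add [j (z - p) (z - p)]. *)
Lemma approximating_path_fixed_point_le (t : R) z p : approximating_path t z ->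
  fixed_points C T p -> `|z - p| ^+ 2 <= j (z - p) (u - p).
Proof.
move=> zP [Cp Tp]; have [/andP[t0 t1] _ _] := zP.
have := @approximating_path_le t 0 z p zP Cp.
rewrite Tp subrr normr0 lexx mul0r mulr0 pmulr_rle0// => /(_ isT).
rewrite -opprB (duality_mapNl jP).
have -> : u - p = (u - z) + (z - p) by rewrite subrKA.
by rewrite (duality_mapDr jP _ (u - z)) (duality_map_self jP); lra.
Qed.

(* The asymptotic center of a path with parameter tending to [0] is [T]-invariant,
   hence contains a fixed point [p]. If the path stayed away from [p], moving [p]
   slightly towards [u] would decrease all the distances to the path uniformly. *)
Theorem approximating_path_cluster : reflexive_space E ->
  nonexpansive_fixed_point_property E -> fixed_points C T !=set0 ->
  exists2 p, fixed_points C T p & forall e : R, 0 < e ->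
    exists t z, approximating_path t z /\ `|z - p| <= e.
Proof.
move=> Erefl Efpp [w Fw].
have /choice[z zP] (n : nat) : exists z, approximating_path n.+1%:R^-1 z.
  by apply: approximating_path_exists; rewrite invr_gt0 ltr0Sn invf_le1 ?ltr0Sn// ler1n.
have Cz n : C (z n) by have [] := zP n.
have zw n : `|z n - w| <= `|u - w| by exact: approximating_path_bounded (zP n) Fw.
have zM n : `|z n| <= `|u - w| + `|w|.
  by have := ler_normD (z n - w) w; rewrite subrK; have := zw n; lra.
have C0 : C !=set0 by exists u.
have [r [r0 rmin]] := asymptotic_center C0 C_closed C_convex Erefl zM.
have zT n : `|z n - T (z n)| <= n.+1%:R^-1 * (2 * `|u - w|).
  have [/andP[t0 t1] _ zE] := zP n; have [Cw Tw] := Fw.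
  have -> : z n - T (z n) = n.+1%:R^-1 *: (u - T (z n)).
    by rewrite {1}zE scalerBl scale1r addrA addrAC addrK scalerBr addrC.
  rewrite normrZ gtr0_norm// ler_pM2l//.
  have := T_ne (Cz n) Cw; have := ler_distD w u (T (z n)).
  by rewrite Tw (distrC w (T _)); have := zw n; lra.
have Tr : set_fun (asymptotic_ball C z r) (asymptotic_ball C z r) T.
  move=> y [Cy ry]; split; first exact: T_self.
  move=> e e0; have e20 : 0 < e / 2 by rewrite divr_gt0.
  have [N hN] := ry _ e20.
  pose P := Num.truncn (2 * `|u - w| / (e / 2)).
  exists (maxn N P) => n; rewrite geq_max => /andP[/hN nN nP].
  have nw : n.+1%:R^-1 * (2 * `|u - w|) <= e / 2.
    rewrite mulrC ler_pdivrMr ?ltr0Sn// [leRHS]mulrC -ler_pdivrMr//.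
    by apply/ltW/(lt_le_trans (truncnS_gt _)); rewrite ler_nat ltnS.
  have := ler_distD (T (z n)) (z n) (T y).
  by have := le_trans (zT n) nw; have := T_ne (Cz n) Cy; lra.
have ballC : asymptotic_ball C z r `<=` C by move=> y [].
have [||||p [[Cp rp] Tp]] := Efpp (asymptotic_ball C z r) r0 _ _ _ T Tr.
- exact: asymptotic_ball_bounded zM.
- exact: asymptotic_ball_closed.
- exact: asymptotic_ball_convex.
- by move=> x y /ballC Cx /ballC Cy; exact: T_ne.
have Fp : fixed_points C T p by [].
exists p => // e e0; apply: contrapT => far.
have zfar n : e < `|z n - p|.
  by rewrite ltNge; apply/negP => zpe; apply: far; exists n.+1%:R^-1, (z n).
set b := `|u - p|.
have zb n : `|z n - p| <= b by exact: approximating_path_bounded (zP n) Fp.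
have b0 : 0 < b by apply: lt_le_trans (zb 0%N); exact: lt_trans (zfar 0%N).
have e20 : 0 < e ^+ 2 / 2 by rewrite divr_gt0// exprn_gt0.
have [d d0 hd] := duality_map_unif_continuous jP (2 * b) (u - p) e20.
pose s := Num.min 1 (d / b).
have s0 : 0 < s by rewrite lt_min ltr01 divr_gt0.
have s1 : s <= 1 by rewrite ge_min lexx.
have sd : s * b <= d by rewrite -ler_pdivlMr// ge_min lexx orbT.
clearbody s; pose p' := s *: u + (1 - s) *: p.
have zp' n : z n - p' = (z n - p) - s *: (u - p).
  by rewrite /p' scalerBl scale1r addrCA -scalerBr opprD addrA.
(* The subgradient inequality gives [|z n - p'| ^+ 2 <= a ^+ 2 - s e ^+ 2 = a ^+ 2 - 2 b k] with
   [a = |z n - p| <= b], which is less than [(a - k) ^+ 2]. *)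
pose k := s * e ^+ 2 / (2 * b).
have k0 : 0 < k by rewrite divr_gt0// mulr_gt0// exprn_gt0.
have dist n : `|z n - p'| <= `|z n - p| - k.
  have a0 := zfar n; have ab := zb n; rewrite zp'.
  have nsv : `|s *: (u - p)| = s * b by rewrite normrZ gtr0_norm.
  have sb1 : s * b <= b by rewrite ler_piMl// ltW.
  have xb : `|z n - p - s *: (u - p)| <= 2 * b.
    by have := ler_normB (z n - p) (s *: (u - p)); rewrite nsv; lra.
  have xd : `|z n - p - (z n - p - s *: (u - p))| <= d by rewrite subKr nsv.
  have ab2 : `|z n - p| <= 2 * b by lra.
  have := hd _ _ ab2 xb xd; have := approximating_path_fixed_point_le (zP n) Fp.
  have := duality_map_subgradient jP (z n - p - s *: (u - p)) (s *: (u - p)).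
  rewrite subrK (duality_mapZr jP).
  set x := `|z n - p - _|; set a := `|z n - p| in a0 ab ab2 *.
  set J := j (_ - _ - _) _; set J0 := j _ _.
  move=> h1 h2; rewrite ler_norml => /andP[_ h3].
  have x0 : 0 <= x := normr_ge0 _.
  have kb : 2 * b * k = s * e ^+ 2 by rewrite /k mulrC divfK// gt_eqF// mulr_gt0.
  have ea : e ^+ 2 <= a ^+ 2 by rewrite lerXn2r ?nnegrE ?(ltW e0) ?normr_ge0 ?(ltW a0).
  have eJ : e ^+ 2 <= 2 * J by lra.
  have : s * e ^+ 2 <= s * (2 * J) by rewrite ler_pM2l.
  rewrite -kb => sJ; clearbody x a J J0 k b.
  have ak : a * k <= b * k by rewrite ler_pM2r.
  have ka : 2 * k <= a.
    have a1 : 0 < a by exact: lt_trans a0.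
    by rewrite -(ler_pM2l a1); have := sqr_ge0 x; lra.
  rewrite leNgt; apply/negP => kx.
  have : (a - k) ^+ 2 <= x ^+ 2 by rewrite lerXn2r// ?nnegrE ?(ltW kx)//; lra.
  by have := exprn_gt0 2 k0; lra.
suff : r <= r - k by lra.
apply: rmin; exists p'; split.
  by apply: convex_set_combination => //; rewrite ltW.
move=> e' e'0; have [N hN] := rp e' e'0; exists N => n /hN.
by have := dist n; lra.
Qed.

(** Replace [p] by one path point [z] near it. As [z] and its parameter [t] are fixed before [d],
    the division by [t] in the path estimate is harmless. *)
Lemma approximate_fixed_point_le (p : E) (M e : R) : C p ->
  (forall e : R, 0 < e -> exists t z, approximating_path t z /\ `|z - p| <= e) ->
  0 < e -> exists2 d : R, 0 < d & forall y, C y -> `|y - p| <= M ->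
    `|y - T y| <= d -> j (y - p) (u - p) <= e.
Proof.
move=> Cp pcl e0; have e30 : 0 < e / 3 by rewrite divr_gt0.
pose m := `|M| + 1; have m0 : 0 < m by rewrite ltr_wpDl.
have [d d0 hd] := duality_map_unif_continuous jP m (u - p) e30.
(* The three bounds keep [|y - z| <= m], allow exchanging [y - p] for [y - z], and make
   [j (y - z) (z - p)] at most [e / 3]. *)
pose c := Num.min (Num.min 1 d) (e / 3 / m).
have c0 : 0 < c by rewrite !lt_min ltr01 d0 divr_gt0.
have [t [z [zP zc]]] := pcl c c0; have [/andP[t0 t1] Cz _] := zP.
move: zc; rewrite !le_min ler_pdivlMr// => /andP[/andP[z1 zd] zm].
exists (e / 3 * t / m); first by rewrite divr_gt0// mulr_gt0.
move=> y Cy yM yT.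
have ypm : `|y - p| <= m by rewrite /m; have := ler_norm M; lra.
have yzm : `|y - z| <= m.
  have := ler_distD p y z; rewrite (distrC p z) /m; have := ler_norm M; lra.
have yzd : `|y - p - (y - z)| <= d by rewrite opprB addrC subrKA distrC distrC.
have := hd _ _ ypm yzm yzd; rewrite ler_norml => /andP[_ h1].
have h2 : j (y - z) (z - p) <= e / 3.
  apply: le_trans (duality_map_le jP _ _) _.
  by apply: le_trans zm; rewrite mulrC ler_wpM2l.
have h3 : j (y - z) (u - z) <= e / 3.
  rewrite -(ler_pM2l t0); apply: le_trans (approximating_path_le zP Cy yT) _.
  apply: le_trans (_ : e / 3 * t / m * `|y - z| <= _).
    apply: ler_piMl; last by rewrite gerBl ltW.
    by rewrite mulr_ge0// divr_ge0 ?(ltW m0)// mulr_ge0 ?(ltW t0)// ltW.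
  by rewrite mulrAC ler_pdivrMr// (mulrC t) ler_wpM2l// mulr_ge0 ?ltW.
have : j (y - z) (u - p) = j (y - z) (u - z) + j (y - z) (z - p).
  by rewrite -(duality_mapDr jP) subrKA.
by lra.
Qed.

End approximating_path.

(** * Sunny retractions *)

Section sunny_retraction.
Variables (R : realType) (E : normedModType R).
Variables (j : E -> E -> R) (jP : uniform_duality_map j).
Variables (C F : set E) (FC : F `<=` C).
Implicit Types (x p w : E) (Q : E -> E).

(** Each inequality tested at the other point, then added: [|p' - p| ^+ 2 <= 0]. *)
Lemma variational_unique x p p' : F p -> F p' ->
  (forall w, F w -> j (w - p) (x - p) <= 0) ->
  (forall w, F w -> j (w - p') (x - p') <= 0) -> p = p'.
Proof.
move=> Fp Fp' /(_ _ Fp') h /(_ _ Fp).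
rewrite -opprB (duality_mapNl jP) => h'.
have : j (p' - p) ((x - p) - (x - p')) <= 0 by rewrite (duality_mapBr jP); lra.
have -> : x - p - (x - p') = p' - p by rewrite opprB addrC subrKA.
rewrite (duality_map_self jP) => h2; apply/esym/eqP.
by rewrite -subr_eq0 -normr_eq0 -sqrf_eq0 eq_le h2 exprn_ge0.
Qed.

(** [Q x] also solves the inequality of each point [Q x + l (x - Q x)] of [C], so uniqueness gives
    sunniness. Testing the inequalities of [x] and [y] at [Q y] and [Q x] and adding gives
    nonexpansiveness. *)
Lemma variational_sunny Q :
  (forall x, C x -> F (Q x) /\ forall w, F w -> j (w - Q x) (x - Q x) <= 0) ->
  sunny_nonexpansive_retraction C F Q.
Proof.
move=> QP.
have QF w : F w -> Q w = w.
  move=> Fw; have [FQw h] := QP w (FC Fw).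
  by apply: (variational_unique FQw Fw h) => v _; rewrite subrr (duality_map0r jP).
split; first split => //.
- by move=> x /QP[].
- by move=> w Fw; exists w; [exact: FC|exact: QF].
- move=> x l Cx l0 Cv; have [FQx h] := QP x Cx; have [FQv hv] := QP _ Cv.
  apply: (variational_unique FQv FQx hv) => w Fw.
  rewrite [_ + _ - _]addrAC subrr add0r (duality_mapZr jP).
  by rewrite mulr_ge0_le0// h.
- move=> x y /QP[Fx hx] /QP[Fy hy].
  have := hy _ Fx; have := hx _ Fy; set D := Q y - Q x.
  rewrite -(opprB (Q y) (Q x)) -/D (duality_mapNl jP) => h1 h2.
  have : `|D| ^+ 2 <= j D (y - x).
    rewrite -(duality_map_self jP); suff : j D (D - (y - x)) <= 0.
      by rewrite (duality_mapBr jP); lra.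
    have -> : D - (y - x) = (x - Q x) - (y - Q y).
      by rewrite /D !opprB addrC addrACA [RHS]addrACA [- y - _]addrC.
    by rewrite (duality_mapBr jP); lra.
  clearbody D => /le_trans/(_ (duality_map_le jP _ _)).
  rewrite normrN [`|x - y|]distrC.
  have [D0|D0] := eqVneq D 0; first by rewrite D0 normr0.
  by rewrite expr2 ler_pM2l// normr_gt0.
Qed.

(** Along [Q x + t v] the retraction is constant, so nonexpansiveness gives
    [|Q x - w| <= |Q x - w + t v|]: the squared norm has nonnegative slope at [Q x - w] in direction
    [v]. *)
Lemma sunny_variational Q x w : convex_set C ->
  sunny_nonexpansive_retraction C F Q -> C x -> F w ->
  j (w - Q x) (x - Q x) <= 0.
Proof.
move=> cC [[QF _ Qid] Qs Qn] Cx Fw.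
rewrite -opprB (duality_mapNl jP) oppr_le0; set v := x - Q x.
rewrite -oppr_le0; apply/ler_addgt0Pr => e e0; rewrite add0r.
have [d d0 hd] := jP `|Q x - w| v e0.
pose t := Num.min d 1.
have t0 : 0 < t by rewrite lt_min d0 ltr01.
have t1 : t <= 1 by rewrite ge_min lexx orbT.
have td : `|t| <= d by rewrite gtr0_norm// ge_min lexx.
have CQ : C (Q x) by apply/FC/QF.
have Cv : C (Q x + t *: v).
  have -> : Q x + t *: v = t *: x + (1 - t) *: Q x.
    by rewrite /v scalerBr scalerBl scale1r addrCA.
  by apply: convex_set_combination => //; rewrite (ltW t0).
have := Qn _ _ Cv (FC Fw).
rewrite (Qs _ _ Cx (ltW t0) Cv) (Qid _ Fw) addrAC => h.
have h2 : `|Q x - w| ^+ 2 <= `|Q x - w + t *: v| ^+ 2 by rewrite lerXn2r// nnegrE.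
have := hd _ t (lexx _) td; rewrite (gtr0_norm t0) ler_norml => /andP[_ h3].
have := mulr_gt0 e0 t0.
by move=> ?; rewrite -(ler_pM2l t0); lra.
Qed.
End sunny_retraction.

(** * The Halpern iteration *)

(** If every [d = 1 / (n + 1)] failed, the counterexamples would form a sequence violating the
    sequential definition against the constant sequence [p]. *)
Lemma strongly_nonexpansive_modulus (R : realType) (E : normedModType R)
    (C : set E) (T : E -> E) (p : E) (M e : R) :
  strongly_nonexpansive C T -> fixed_points C T p -> 0 < e ->
  exists2 d : R, 0 < d & forall y, C y -> `|y - p| <= M ->
    `|y - p| - `|T y - p| <= d -> `|y - T y| <= e.
Proof.
move=> [T_ne T_s] [Cp Tp] e0; apply: contrapT => no_d.
have /choice[y yP] (n : nat) : exists y, [/\ C y, `|y - p| <= M,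
    `|y - p| - `|T y - p| <= n.+1%:R^-1 & e < `|y - T y|].
  apply: contrapT => no_y; apply: no_d; exists n.+1%:R^-1.
    by rewrite invr_gt0 ltr0Sn.
  move=> y Cy yM yd; rewrite leNgt; apply/negP => ye.
  by apply: no_y; exists y.
have Cy n : C (y n) by have [] := yP n.
have ybd : bounded_fun (fun n => y n - p).
  exists M; split; first exact: num_real.
  by move=> N MN n _ /=; have [_ /le_trans + _ _] := yP n; apply; exact: ltW.
have ycvg : `|y n - p| - `|T (y n) - T p| @[n --> \oo] --> (0 : R).
  apply: (squeeze_cvgr _ (cvg_cst 0) cvg_harmonic).
  apply: nearW => n; have [_ _ yn _] := yP n.
  by rewrite Tp yn andbT subr_ge0 -{1}Tp T_ne.
have /cvgrPdist_lt/(_ e e0)[N _ /(_ N (leqnn N))/=] :=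
  T_s y (fun=> p) Cy (fun=> Cp) ybd ycvg.
rewrite sub0r normrN Tp opprB addrA subrK.
by have [_ _ _ /ltW] := yP N; rewrite leNgt => /negP.
Qed.

(* As long as [a n > b], the sequence [a ^+ 2] drops by at least [c * alpha n],
   which cannot last since the series diverges; and [a n <= b] is eventually stable. *)
Lemma divergent_weights_cvg0 (R : realType) (alpha a eta : nat -> R) (k : R) :
  (forall n, 0 < alpha n <= 1) -> alpha @ \oo --> (0 : R) ->
  series alpha @ \oo --> +oo%R ->
  (forall n, 0 <= a n) ->
  (forall n, a n.+1 <= a n - eta n + alpha n * k) ->
  (forall e : R, 0 < e -> exists2 d : R, 0 < d & exists N, forall n, (N <= n)%N ->
     eta n <= d -> a n.+1 ^+ 2 <= (1 - alpha n) * a n ^+ 2 + alpha n * e) ->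
  a @ \oo --> (0 : R).
Proof.
move=> alpha01 alpha0 alphaoo a0 a_eta a_sq.
apply/cvgr0Pnorm_le => b b0; have b20 : 0 < b ^+ 2 / 2 by rewrite divr_gt0// exprn_gt0.
have [d d0 [N1 hN1]] := a_sq _ b20.
have k1 : 0 < `|k| + 1 by rewrite ltr_wpDl.
have dk : 0 < d / 2 / (`|k| + 1) by rewrite !divr_gt0.
have /cvgr0Pnorm_le/(_ _ dk)[N2 _ hN2] := alpha0.
have ak n : (N2 <= n)%N -> alpha n * k <= d / 2.
  move=> /hN2 /=; have /andP[al0 _] := alpha01 n.
  rewrite gtr0_norm// ler_pdivlMr//; apply: le_trans.
  by rewrite ler_wpM2l ?(ltW al0)// (le_trans (ler_norm k))// lerDl.
pose N := maxn N1 N2.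
have step n : (N <= n)%N -> a n.+1 <= a n - d / 2 \/
    a n.+1 ^+ 2 <= (1 - alpha n) * a n ^+ 2 + alpha n * (b ^+ 2 / 2).
  rewrite geq_max => /andP[n1 n2]; have [ed|de] := leP (eta n) d.
    by right; exact: hN1.
  by left; have := a_eta n; have := ak n n2; lra.
have stable n : (N <= n)%N -> a n <= b -> a n.+1 <= b.
  move=> nN ab; have [h|h] := step n nN; first lra.
  have /andP[al0 al1] := alpha01 n.
  rewrite -(@ler_pXn2r _ 2%N)// ?nnegrE ?(ltW b0)//; apply: le_trans h _.
  have : a n ^+ 2 <= b ^+ 2 by rewrite lerXn2r// nnegrE// ltW.
  have : 0 <= 1 - alpha n by rewrite subr_ge0.
  by nra.
(* While [a n > b], the square drops by [d / 2 * b] in the first alternative of [step] and by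
   [alpha n * (b ^+ 2 / 2)] in the second. *)
pose c := Num.min (b ^+ 2 / 2) (d / 2 * b).
have c0 : 0 < c by rewrite lt_min b20 mulr_gt0// divr_gt0.
have drop n : (N <= n)%N -> b < a n -> a n.+1 ^+ 2 <= a n ^+ 2 - c * alpha n.
  move=> nN ba; have /andP[al0 al1] := alpha01 n.
  have [h|h] := step n nN.
    have cd : c <= d / 2 * b by rewrite ge_min lexx orbT.
    have h1 : a n.+1 ^+ 2 <= (a n - d / 2) * a n.
      have an1 := a0 n.+1; rewrite expr2; apply: ler_pM => //; lra.
    have h2 : d / 2 * b <= d / 2 * a n by rewrite ler_pM2l ?ltW// divr_gt0.
    have h3 : c * alpha n <= c by rewrite ler_piMr// ltW.
    by lra.
  have cb : c <= b ^+ 2 / 2 by rewrite ge_min lexx.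
  have h1 : b ^+ 2 <= a n ^+ 2 by rewrite lerXn2r// ?nnegrE// ltW.
  have h2 : alpha n * c <= alpha n * (b ^+ 2 / 2) by rewrite ler_pM2l.
  have h3 : alpha n * b ^+ 2 <= alpha n * a n ^+ 2 by rewrite ler_pM2l.
  by lra.
have [n0 n0N an0] : exists2 n, (N <= n)%N & a n <= b.
  apply: contrapT => no_n.
  have ab n : (N <= n)%N -> b < a n.
    by move=> nN; rewrite ltNge; apply/negP => anb; apply: no_n; exists n.
  have tel n : a (N + n)%N ^+ 2 <=
      a N ^+ 2 - c * (series alpha (N + n)%N - series alpha N).
    elim: n => [|n IH]; first by rewrite addn0 subrr mulr0 subr0.
    rewrite addnS seriesSr.
    by apply: le_trans (drop _ (leq_addr _ _) (ab _ (leq_addr _ _))) _; lra.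
  (* At this partial sum the telescoped bound would make a square at most [- 1]. *)
  have /cvgryPge/(_ (series alpha N + (a N ^+ 2 + 1) / c))[P _ hP] := alphaoo.
  have := hP _ (leq_addl N P); have := tel P; have := sqr_ge0 (a (N + P)%N).
  rewrite -lerBrDl /= ler_pdivrMr//; lra.
exists n0 => // n /= n0n; rewrite ger0_norm//.
elim: n n0n => [|n IH]; first by rewrite leqn0 => /eqP <-.
rewrite leq_eqVlt => /predU1P[<-//|n0n]; apply: stable; last exact: IH.
exact: leq_trans n0N n0n.
Qed.

(** Applies the preceding lemma to [|x n - p|], with [eta n] the loss of distance under [T]. A small
    loss makes [x n] an approximate fixed point and [x n.+1] close to [x n]. *)
Lemma halpern_cvg (R : realType) (E : completeNormedModType R)
    (j : E -> E -> R) (C : set E) (alpha : nat -> R) (u p : E) (T : E -> E)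
    (x : nat -> E) :
  uniform_duality_map j -> convex_set C ->
  (forall n, 0 < alpha n <= 1) -> alpha @ \oo --> (0 : R) ->
  series alpha @ \oo --> +oo%R -> C u -> set_fun C C T ->
  strongly_nonexpansive C T -> C (x 0%N) ->
  (forall n, x n.+1 = alpha n *: u + (1 - alpha n) *: T (x n)) ->
  fixed_points C T p ->
  (forall e : R, 0 < e -> exists t z, approximating_path C T u t z /\ `|z - p| <= e) ->
  x @ \oo --> p.
Proof.
move=> jP cC alpha01 alpha0 alphaoo Cu T_self T_s x0C x_rec Fp pcl.
have [T_ne _] := T_s; have [Cp Tp] := Fp.
have Cx n : C (x n).
  elim: n => // n IH; rewrite x_rec; have /andP[al0 al1] := alpha01 n.
  by apply: convex_set_combination => //; [exact: T_self|rewrite (ltW al0)].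
have TxP n : `|T (x n) - p| <= `|x n - p| by rewrite -{1}Tp T_ne.
have x_recB n : x n.+1 - p = alpha n *: (u - p) + (1 - alpha n) *: (T (x n) - p).
  by rewrite x_rec -opprB sub_convex_combination opprD -!scalerN !opprB.
have x_step n : `|x n.+1 - p| <= alpha n * `|u - p| + (1 - alpha n) * `|T (x n) - p|.
  have /andP[al0 al1] := alpha01 n.
  rewrite x_recB; apply: le_trans (ler_normD _ _) _.
  by rewrite !normrZ gtr0_norm// ger0_norm// subr_ge0.
pose M := `|x 0%N - p| + `|u - p|.
have uM : `|u - p| <= M by rewrite lerDr.
have xM n : `|x n - p| <= M.
  elim: n => [|n IH]; first by rewrite lerDl.
  have /andP[al0 al1] := alpha01 n.
  apply: le_trans (x_step n) _.
  have -> : M = alpha n * M + (1 - alpha n) * M by ring.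
  apply: lerD; apply: ler_wpM2l; rewrite ?subr_ge0 ?(ltW al0)//.
  exact: le_trans (TxP n) IH.
apply/cvgrPdist_le => e e0.
have : (fun n => `|x n - p|) @ \oo --> (0 : R).
  apply: (@divergent_weights_cvg0 _ alpha _
    (fun n => `|x n - p| - `|T (x n) - p|) `|u - p|) => //.
    move=> n; have /andP[al0 al1] := alpha01 n.
    apply: le_trans (x_step n) _.
    have : 0 <= alpha n * `|T (x n) - p| by rewrite mulr_ge0// ltW.
    by lra.
  move=> e1 e10; have e14 : 0 < e1 / 4 by rewrite divr_gt0.
  have [d1 d10 h1] := approximate_fixed_point_le jP T_ne M Cp pcl e14.
  have [d2 d20 h2] := duality_map_unif_continuous jP M (u - p) e14.
  pose d3 := Num.min d1 (d2 / 2).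
  have d30 : 0 < d3 by rewrite lt_min d10 divr_gt0.
  have [d d0 hd] := strongly_nonexpansive_modulus M T_s Fp d30.
  exists d => //.
  have M1 : 0 < 2 * M + 1 by rewrite ltr_wpDl// mulr_ge0// addr_ge0.
  (* Since [|u - T (x n)| <= 2 M], this bound on [alpha n] and [d3 <= d2 / 2] together give
     [|x n.+1 - x n| <= d2]. *)
  have d4 : 0 < d2 / 2 / (2 * M + 1) by rewrite !divr_gt0.
  have /cvgr0Pnorm_le/(_ _ d4)[N _ hN] := alpha0.
  exists N => n /hN /=; have /andP[al0 al1] := alpha01 n.
  rewrite gtr0_norm// ler_pdivlMr// => alM xd.
  have := hd _ (Cx n) (xM n) xd; rewrite le_min => /andP[xT1 xT2].
  have j1 := h1 _ (Cx n) (xM n) xT1.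
  have xx : `|x n.+1 - p - (x n - p)| <= d2.
    rewrite opprB addrA subrK.
    have -> : x n.+1 - x n = alpha n *: (u - T (x n)) - (x n - T (x n)).
      rewrite x_rec scalerBl scale1r scalerBr opprB.
      by rewrite [RHS]addrA; congr (_ - _); rewrite addrA addrAC.
    apply: le_trans (ler_normB _ _) _; rewrite normrZ gtr0_norm//.
    have : alpha n * `|u - T (x n)| <= alpha n * (2 * M).
      rewrite ler_pM2l//; have := ler_distD p u (T (x n)).
      by rewrite (distrC p); have := TxP n; have := xM n; lra.
    by lra.
  have := h2 _ _ (xM n.+1) (xM n) xx; rewrite ler_norml => /andP[_ j2].
  (* Removing [alpha n (u - p)] from [x n.+1 - p] leaves [(1 - alpha n) (T (x n) - p)]. *)
  have := duality_map_subgradient jP (x n.+1 - p) (- (alpha n *: (u - p))).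
  rewrite (duality_mapNr jP) (duality_mapZr jP) {3}x_recB addrAC subrr add0r.
  rewrite normrZ ger0_norm ?subr_ge0// => j3.
  have j4 : alpha n * j (x n.+1 - p) (u - p) <= alpha n * (e1 / 2).
    by rewrite ler_pM2l//; lra.
  have : ((1 - alpha n) * `|T (x n) - p|) ^+ 2 <= (1 - alpha n) * `|x n - p| ^+ 2.
    rewrite exprMn expr2 -mulrA ler_wpM2l ?subr_ge0//.
    apply: le_trans (_ : 1 * `|T (x n) - p| ^+ 2 <= _).
      by rewrite ler_wpM2r// ?exprn_ge0// gerBl ltW.
    by rewrite mul1r lerXn2r// nnegrE.
  by lra.
move=> /cvgr0Pnorm_le/(_ e e0); apply: filterS => n.
by rewrite normr_id distrC.
Qed.

(** Indices start at [0], so [x 0] and [alpha 0] are the first terms. Mappings are total functions,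
    hence [Q] is unique only as a mapping on [C]. *)
Theorem corollary3p6 (R : realType) (E : completeNormedModType R)
    (E_reflexive : reflexive_space E)
    (E_uGd : uniformly_Gateaux_differentiable_norm E)
    (E_fpp : nonexpansive_fixed_point_property E)
    (C : set E) (C_neq0 : C !=set0) (C_closed : closed C)
    (C_convex : convex_set C)
    (alpha : nat -> R)
    (alpha_itv : forall n, 0 < alpha n <= 1)
    (alpha_cvg0 : alpha @ \oo --> (0 : R))
    (alpha_sum : series alpha @ \oo --> +oo%R)
    (u : E) (Cu : C u)
    (T : E -> E) (T_self : set_fun C C T) (T_sne : strongly_nonexpansive C T)
    (x : nat -> E) (x0C : C (x 0%N))
    (x_rec : forall n, x n.+1 = alpha n *: u + (1 - alpha n) *: T (x n))
    (T_fix : fixed_points C T !=set0) :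
  exists Q : E -> E,
    [/\ sunny_nonexpansive_retraction C (fixed_points C T) Q,
        forall Q' : E -> E,
          sunny_nonexpansive_retraction C (fixed_points C T) Q' ->
          forall z, C z -> Q' z = Q z
      & x @ \oo --> Q u].
Proof.
have [j jP] := uGd_duality_map E_uGd.
have T_ne := T_sne.1; have FC : fixed_points C T `<=` C by move=> y [].
(* [Q v] is a strong cluster point of the path anchored at [v]; outside [C] its value is
   arbitrary. *)
have /choice[Q QP] (v : E) : exists p, C v -> fixed_points C T p /\
    forall e : R, 0 < e -> exists t z, approximating_path C T v t z /\ `|z - p| <= e.
  have [Cv|] := pselect (C v); last by exists v.
  have [p Fp pP] := approximating_path_cluster jP C_closed C_convex T_self T_ne
    Cv E_reflexive E_fpp T_fix.
  by exists p.
have Qvar v : C v -> fixed_points C T (Q v) /\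
    forall w, fixed_points C T w -> j (w - Q v) (v - Q v) <= 0.
  move=> /QP[FQv Qcl]; split => // w [Cw Tw]; apply/ler_addgt0Pr => e e0.
  have [d d0 h] := approximate_fixed_point_le jP T_ne `|w - Q v| (FC _ FQv) Qcl e0.
  by rewrite add0r h// Tw subrr normr0 ltW.
exists Q; split.
- exact (variational_sunny jP FC Qvar).
- move=> Q' Q'P z Cz; have [FQz hQ] := Qvar z Cz.
  apply: (variational_unique jP _ FQz _ hQ) => [|w Fw].
    by have [[Q'F _ _] _ _] := Q'P; exact: Q'F.
  exact: (sunny_variational jP FC C_convex Q'P Cz Fw).
- have [FQu Qcl] := QP u Cu.
  exact: (halpern_cvg jP C_convex alpha_itv alpha_cvg0 alpha_sum Cu T_self
    T_sne x0C x_rec FQu Qcl).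
Qed.
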